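(* Let $G$ and $H$ be arbitrary non-trivial graphs where $H$ is not isomorphic to $K_2$. Then $tn(G\circ H)=2$ if and only if $G$ has a universal vertex and $tn(H)=2$.
   Context: All graphs are finite, undirected, without loops or multiple edges; a graph is non-trivial if it has at least two vertices. A universal vertex is a vertex adjacent to all other vertices of the graph. The lexicographic product $G\circ H$ has vertex set $V(G)\times V(H)$, and $(g_1,h_1)$, $(g_2,h_2)$ are adjacent if either $g_1g_2\in E(G)$ or ($g_1=g_2$ and $h_1h_2\in E(H)$). For distinct non-adjacent vertices $u,v$ of a graph $F$, a tolled walk between $u$ and $v$ is a sequence of vertices $u,w_1,\ldots,w_k,v$ with $k\ge 1$ such that $w_iw_{i+1}\in E(F)$ for all $1\le i<k$, $uw_i\in E(F)$ if and only if $i=1$, and $vw_i\in E(F)$ if and only if $i=k$. If $uv\in E(F)$, the only tolled walk between $u$ and $v$ is $u,v$; the only tolled walk from $v$ to $v$ is $v$ itself. The toll interval $T_F(u,v)$ is the set of all vertices lying on some tolled walk between $u$ and $v$. A set $S\subseteq V(F)$ is a toll set of $F$ if $\bigcup_{u,v\in S}T_F(u,v)=V(F)$. The toll number $tn(F)$ is the minimum size of a toll set of $F$. *)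

(* Defs.v *)
From mathcomp Require Import all_boot.
From mathcomp Require Import boolp.

Set Implicit Arguments.
Unset Strict Implicit.
Unset Printing Implicit Defensive.

Record sgraph := SGraph {
  vertex :> finType;
  adj : rel vertex;
  adj_sym : symmetric adj;
  adj_irrefl : irreflexive adj }.

Section Basic.
Variable G : sgraph.

Definition nontrivial : Prop := 2 <= #|G|.

Definition universal (g : G) : Prop := forall x : G, x != g -> adj g x.

Definition has_universal : Prop := exists g : G, universal g.

End Basic.

Definition isomorphic (G H : sgraph) : Prop :=
  exists2 f : G -> H, bijective f & forall x y, adj (f x) (f y) = adj x y.

Section Complete.
Variable n : nat.

Definition complete_adj : rel 'I_n := fun i j => i != j.

Lemma complete_adj_sym : symmetric complete_adj.
Proof. by move=> i j; rewrite /complete_adj eq_sym. Qed.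

Lemma complete_adj_irrefl : irreflexive complete_adj.
Proof. by move=> i; rewrite /complete_adj eqxx. Qed.

Definition complete : sgraph := SGraph complete_adj_sym complete_adj_irrefl.

End Complete.

Section Lexicographic.
Variables G H : sgraph.

Definition lex_adj : rel (G * H)%type := fun p q =>
  adj p.1 q.1 || ((p.1 == q.1) && adj p.2 q.2).

Lemma lex_adj_sym : symmetric lex_adj.
Proof. by move=> p q; rewrite /lex_adj adj_sym eq_sym (adj_sym p.2). Qed.

Lemma lex_adj_irrefl : irreflexive lex_adj.
Proof. by move=> p; rewrite /lex_adj !adj_irrefl andbF. Qed.

Definition lexprod : sgraph := SGraph lex_adj_sym lex_adj_irrefl.

End Lexicographic.

Section Toll.
Variable F : sgraph.
Implicit Types (u v x : F) (w s : seq F) (S : {set F}).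

(* [w] lists the interior vertices w_1, ..., w_k of a tolled walk between     *)
(* distinct non-adjacent vertices; since [nth] counts from 0, w_1 has index 0 *)
(* and w_k has index k - 1.                                                   *)
Definition tolled_interior u v w : Prop :=
  [/\ 1 <= size w,
      sorted (@adj F) w,
      forall i, i < size w -> adj u (nth u w i) = (i == 0) &
      forall i, i < size w -> adj v (nth v w i) = (i.+1 == size w)].

Definition tolled_walk u v s : Prop :=
  if u == v then s = [:: u]
  else if adj u v then s = [:: u; v]
  else exists2 w, tolled_interior u v w & s = u :: rcons w v.

(* Walks may repeat vertices, so their length is unbounded; [`[< _ >]] is the *)
(* classical truth value of the existence of a walk.                          *)
Definition toll_interval u v : {set F} :=
  [set x | `[< exists2 s, tolled_walk u v s & x \in s >]].

Definition toll_set S : bool :=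
  \bigcup_(u in S) \bigcup_(v in S) toll_interval u v == [set: F].

Lemma toll_setT : toll_set [set: F].
Proof.
apply/eqP/setP=> x; rewrite in_setT; apply/bigcupP; exists x => //.
apply/bigcupP; exists x => //; rewrite inE; apply/asboolP.
by exists [:: x]; rewrite ?inE /tolled_walk eqxx.
Qed.

(* [toll_setT] is what makes this minimum meaningful. *)
Definition tn : nat := #|[arg min_(S < [set: F] | toll_set S) #|S|]|.

Lemma tnP : (exists2 S, toll_set S & #|S| = tn) /\
  (forall S, toll_set S -> tn <= #|S|).
Proof.
by rewrite /tn; case: arg_minnP => [|S tS minS]; [exact: toll_setT|split=> //; exists S].
Qed.

End Toll.

(* Main.v *)
Require Import Defs.
From mathcomp Require Import all_boot.
From mathcomp Require Import boolp.

Set Implicit Arguments.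
Unset Strict Implicit.
Unset Printing Implicit Defensive.

(** Toll number 2 means that some pair u, v is a toll set, so the whole theorem
    is about which pairs of vertices of the product have every third vertex in
    the interior of a tolled walk joining them (lemma [tn2P]).

    Suppose (g1, h1), (g2, h2) is such a pair.  First, g1 = g2: otherwise take
    a vertex (g1, h) with h != h1.  All neighbours of (g1, h) outside the layer
    of g1 are also neighbours of (g1, h1), and a tolled walk starting at
    (g1, h1) meets its neighbours only at its first step; so once it visits
    (g1, h) it can never leave the layer of g1, and it cannot end next to
    (g2, h2) (lemma [lex_pair_same_layer]).  Next, put g = g1 = g2.  A vertex
    (x, h) with x adjacent to g is adjacent to both ends, hence can only occur
    in a tolled walk with a single interior vertex; every other tolled walk
    stays in the layer of g, where it is a tolled walk of H
    (lemma [lex_layer_interior]).  Thus vertices (x, h) with x != g are reached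
    only if x is adjacent to g, so g is universal, and the vertices (g, h) are
    reached only through tolled walks of H, so h1, h2 is a toll set of H.

    Conversely, if g is universal and h1, h2 is a toll set of H, then h1 and h2
    are not adjacent because H is not K_2.  Walks of H lift to the layer of g,
    and every vertex outside that layer is a common neighbour of (g, h1) and
    (g, h2), so these two vertices form a toll set of the product. *)

(** * Toll sets of size two *)

Section TollPairs.
Variable F : sgraph.
Implicit Types (u v x y z : F) (w : seq F).

Lemma nontrivial_other x : nontrivial F -> exists y, y != x.
Proof.
case/card_gt1P=> [a [b [_ _ ab]]].
case: (eqVneq a x) => [<-|ax]; last by exists a.
by exists b; rewrite eq_sym.
Qed.

(** A toll set ranges over ordered pairs, so both directions of a walk have to
    be identified. *)
Lemma tolled_interior_rev u v w :
  tolled_interior u v w -> tolled_interior v u (rev w).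
Proof.
case=> w_gt0 w_path uw vw; split.
- by rewrite size_rev.
- rewrite rev_sorted -(eq_sorted (e := @adj F)) // => x y.
  exact: adj_sym.
- move=> i; rewrite size_rev => lt_i; rewrite nth_rev // vw ?ltn_subrL //.
  rewrite subnSK //; case: i lt_i => [|i] lt_i; first by rewrite subn0 eqxx.
  by rewrite ltn_eqF // ltn_subrL.
- move=> i; rewrite size_rev => lt_i; rewrite nth_rev // uw ?ltn_subrL //.
  by rewrite subn_eq0 eqn_leq lt_i.
Qed.

(** For pairwise distinct u, v and z, this says that z is in the toll interval of u and
    v: an adjacent pair has no interior vertices. *)
Definition toll_inner u v z : Prop :=
  ~~ adj u v /\ exists2 w, tolled_interior u v w & z \in w.

Lemma toll_inner_sym u v z : toll_inner u v z -> toll_inner v u z.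
Proof.
case=> nuv [w uvw zw]; split; first by rewrite adj_sym.
by exists (rev w); [exact: tolled_interior_rev | rewrite mem_rev].
Qed.

Lemma toll_intervalP u v z : z != u -> z != v ->
  reflect (u != v /\ toll_inner u v z) (z \in toll_interval u v).
Proof.
move=> zu zv; rewrite inE; apply: (iffP (asboolP _)).
  case=> s; rewrite /tolled_walk; case: eqVneq => [_ -> | _].
    by rewrite inE (negPf zu).
  case: ifPn => [_ -> | nuv]; first by rewrite !inE (negPf zu) (negPf zv).
  case=> w uvw ->; rewrite inE mem_rcons inE (negPf zu) (negPf zv) /= => zw.
  by split=> //; split=> //; exists w.
case=> uv [nuv [w uvw zw]]; exists (u :: rcons w v).
  by rewrite /tolled_walk (negPf uv) (negPf nuv); exists w.
by rewrite inE mem_rcons inE zw !orbT.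
Qed.

Lemma toll_interval_refl u : u \in toll_interval u u.
Proof.
by rewrite inE; apply/asboolP; exists [:: u]; rewrite ?inE // /tolled_walk eqxx.
Qed.

Lemma toll_set_pairP u v : u != v ->
  toll_set [set u; v] <->
  forall z, z != u -> z != v -> toll_inner u v z.
Proof.
move=> uv; split=> [/eqP cov z zu zv | inner].
  have: z \in \bigcup_(a in [set u; v]) \bigcup_(b in [set u; v]) toll_interval a b.
    by rewrite cov inE.
  case/bigcupP=> a a_uv /bigcupP[b b_uv].
  case/set2P: a_uv => ->; case/set2P: b_uv => -> /toll_intervalP[] //;
    rewrite ?eqxx // => _; exact: toll_inner_sym.
apply/eqP/setP=> z; rewrite inE; apply/bigcupP.
have [-> | zu] := eqVneq z u.
  exists u; rewrite ?set21 //; apply/bigcupP.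
  by exists u; [exact: set21 | exact: toll_interval_refl].
have [-> | zv] := eqVneq z v.
  exists v; rewrite ?set22 //; apply/bigcupP.
  by exists v; [exact: set22 | exact: toll_interval_refl].
exists u; rewrite ?set21 //; apply/bigcupP; exists v; rewrite ?set22 //.
by apply/toll_intervalP => //; split=> //; exact: inner.
Qed.

(** A tolled walk from a vertex to itself reaches nothing else, so a single
    vertex cannot cover a non-trivial graph. *)
Lemma toll_set_card_gt1 (S : {set F}) :
  nontrivial F -> toll_set S -> 1 < #|S|.
Proof.
move=> ntF /eqP cov; rewrite ltnNge; apply/negP=> /card_le1P S_le1.
have covP z : exists2 a, a \in S & z \in toll_interval a a.
  have: z \in \bigcup_(a in S) \bigcup_(b in S) toll_interval a b.
    by rewrite cov inE.
  case/bigcupP=> a aS /bigcupP[b bS zab]; exists a => //.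
  by move: bS zab; rewrite (S_le1 a aS) => /eqP ->.
have cov1 z : z \in S.
  have [a aS] := covP z; rewrite inE => /asboolP[s].
  by rewrite /tolled_walk eqxx => ->; rewrite inE => /eqP->.
have /card_gt1P[x [y [_ _ xy]]] := ntF.
by move: (cov1 y); rewrite (S_le1 x (cov1 x)) inE eq_sym (negPf xy).
Qed.

Lemma tn2P : nontrivial F ->
  tn F = 2 <->
  exists u v, u != v /\ forall z, z != u -> z != v -> toll_inner u v z.
Proof.
move=> ntF; have [[S tS S_min] tn_min] := tnP F; split=> [tn2 | [u [v [uv cov]]]].
  have /cards2P[u [v [uv S_uv]]] : #|S| == 2 by rewrite S_min tn2.
  by exists u, v; split=> //; apply/toll_set_pairP; rewrite // -S_uv.
apply/eqP; rewrite eqn_leq -{2}S_min toll_set_card_gt1 // andbT.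
by have := tn_min [set u; v]; rewrite cards2 uv; apply; apply/toll_set_pairP.
Qed.

End TollPairs.

Lemma isomorphic_K2 (F : sgraph) (u v : F) :
  adj u v -> (forall z, z != u -> z = v) -> isomorphic F (complete 2).
Proof.
move=> uv onlyv; have vu : v != u.
  by apply: contraTneq uv => ->; rewrite adj_irrefl.
pose f (x : F) : 'I_2 := if x == u then ord0 else ord_max.
exists f.
  exists (fun i : 'I_2 => if i == ord0 then u else v) => [x | i].
    by rewrite /f; case: (eqVneq x u) => [-> | /onlyv ->].
  rewrite /f; case: (eqVneq i ord0) => [-> | i0]; first by rewrite eqxx.
  by rewrite (negPf vu); case: i i0 => [[|[]]] // lt_i _; apply: val_inj.
move=> x y; rewrite /= /complete_adj /f.
case: (eqVneq x u) => [-> | /onlyv ->]; case: (eqVneq y u) => [-> | /onlyv ->];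
  by rewrite ?adj_irrefl ?uv // adj_sym uv.
Qed.

(** * Tolled walks in a lexicographic product *)

Section LexWalks.
Variables G H : sgraph.
Implicit Types (g x : G) (h : H) (p q : lexprod G H).

Lemma adj_lex_layer g h h' :
  @adj (lexprod G H) (g, h) (g, h') = adj h h'.
Proof. by rewrite /= /lex_adj /= adj_irrefl eqxx. Qed.

Lemma adj_lex_ne p q : p.1 != q.1 -> adj p q = adj p.1 q.1.
Proof. by rewrite /= /lex_adj => /negPf->; rewrite orbF. Qed.

Lemma adj_lex1 p q : adj p.1 q.1 -> adj p q.
Proof. by rewrite /= /lex_adj => ->. Qed.

Lemma tolled_interior_layer g h1 h2 (w : seq H) :
  @tolled_interior (lexprod G H) (g, h1) (g, h2) [seq (g, h) | h <- w] <->
  tolled_interior h1 h2 w.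
Proof.
have adj_nth h h' i : i < size w ->
    @adj (lexprod G H) (g, h') (nth (g, h) [seq (g, y) | y <- w] i)
    = adj h' (nth h w i).
  by move=> lt_i; rewrite (nth_map h) // adj_lex_layer.
rewrite /tolled_interior size_map sorted_map.
rewrite (eq_sorted (e' := @adj H)); last by move=> a b; exact: adj_lex_layer.
split=> -[w_gt0 w_path uw vw]; split=> // i lt_i.
- by rewrite -adj_nth // uw.
- by rewrite -adj_nth // vw.
- by rewrite adj_nth // uw.
- by rewrite adj_nth // vw.
Qed.

(** A vertex outside the layer of g that is adjacent to a vertex of that layer
    is adjacent to both ends, hence it is both the first and the last interior
    vertex.  So a walk with a longer interior can never leave the layer. *)
Lemma lex_layer_interior g h1 h2 (w : seq (lexprod G H)) :
  tolled_interior ((g, h1) : lexprod G H) (g, h2) w ->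
  (exists2 p, w = [:: p] & adj g p.1) \/
  (exists2 w', w = [seq (g, h) | h <- w'] & tolled_interior h1 h2 w').
Proof.
move=> uvw; have [w_gt0 w_path uw vw] := uvw.
have single i : i < size w -> adj g (nth ((g, h1) : lexprod G H) w i).1 ->
    i = 0 /\ size w = 1.
  move=> lt_i gi; move: (uw i lt_i) (vw i lt_i).
  rewrite (set_nth_default (g, h1) (g, h2)) //.
  by rewrite !adj_lex1 // => /esym/eqP-> /esym/eqP.
have [g0 | ng0] := boolP (adj g (nth ((g, h1) : lexprod G H) w 0).1).
  left; have [_ w1] := single 0 w_gt0 g0.
  by case: w {uvw w_gt0 w_path uw vw single} g0 w1 => [|p []] //=; exists p.
right.
have stay i : i < size w -> (nth ((g, h1) : lexprod G H) w i).1 = g.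
  elim: i => [_ | i IH lt_i].
    have := uw 0 w_gt0; rewrite /= /lex_adj /= (negPf ng0) /=.
    by case/andP=> /eqP.
  apply/eqP; have /orP[gi | /andP[/eqP <- _]] := sortedP (g, h1) w_path i lt_i.
    by rewrite IH 1?ltnW // in gi; have [] := single _ lt_i gi.
  by rewrite IH // ltnW.
have w_lift : w = [seq (g, h) | h <- [seq p.2 | p <- w]].
  rewrite -map_comp; apply: (@eq_from_nth _ ((g, h1) : lexprod G H)) => [|i lt_i].
    by rewrite size_map.
  rewrite (nth_map ((g, h1) : lexprod G H)) //= -{2}(stay i lt_i).
  exact: surjective_pairing.
exists [seq p.2 | p <- w] => //.
by apply/(tolled_interior_layer g); rewrite -w_lift.
Qed.

(** Outside their layer, (u.1, h) and u have the same neighbours, and u may see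
    only the first step of the walk; so a walk through (u.1, h) gets stuck in
    the layer of u, away from the neighbours of v.  In the main argument
    (u.1, h) is known to differ from v only when the layers differ, which is why
    the inner vertex is assumed under that condition. *)
Lemma lex_pair_same_layer (u v : lexprod G H) h :
  h != u.2 -> (u.1 != v.1 -> toll_inner u v (u.1, h)) -> u.1 = v.1.
Proof.
move=> hu inner; apply/eqP/negPn/negP=> uv.
have [nuv [w [w_gt0 w_path uw vw] zw]] := inner uv.
have nuv1 : adj v.1 u.1 = false.
  by rewrite adj_sym; apply: contraNF nuv; exact: adj_lex1.
(* From (u.1, h) on, the walk stays in the layer of u: the index is never 0
   again, and leaving the layer would lead to a neighbour of u. *)
have stay k : index ((u.1, h) : lexprod G H) w + k < size w ->
    (nth u w (index ((u.1, h) : lexprod G H) w + k)).1 = u.1.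
  elim: k => [_ | k IH]; first by rewrite addn0 nth_index.
  rewrite addnS => lt_k; have {}IH := IH (ltnW lt_k).
  have /orP[uk | /andP[/eqP <- _]] := sortedP u w_path _ lt_k; last exact: IH.
  by rewrite IH in uk; have := uw _ lt_k; rewrite adj_lex1.
have lt_last : (size w).-1 < size w by rewrite prednK.
have := vw _ lt_last; rewrite prednK // eqxx (set_nth_default u) //.
have := stay ((size w).-1 - index ((u.1, h) : lexprod G H) w).
rewrite subnKC; last by rewrite -ltnS prednK // index_mem.
move=> /(_ lt_last) last1.
by rewrite adj_lex_ne ?last1 ?nuv1 // eq_sym.
Qed.

(** A common neighbour of both ends is by itself the interior of a tolled
    walk. *)
Lemma lex_inner_outside g x h1 h2 h : adj g x -> ~~ adj h1 h2 ->
  @toll_inner (lexprod G H) (g, h1) (g, h2) (x, h).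
Proof.
move=> gx nh; split; first by rewrite adj_lex_layer.
exists [:: (x, h)]; rewrite ?mem_head //.
by split=> // -[] // _; rewrite [LHS]adj_lex1.
Qed.

Lemma lex_inner_layer g h1 h2 h :
  @toll_inner (lexprod G H) (g, h1) (g, h2) (g, h) <-> toll_inner h1 h2 h.
Proof.
split=> -[nh [w hw zw]].
  rewrite adj_lex_layer in nh; split=> //.
  have [[p w_p gp] | [w' w_w' hw']] := lex_layer_interior hw.
    by move: zw gp; rewrite w_p inE => /eqP <-; rewrite /= adj_irrefl.
  exists w' => //; move: zw; rewrite w_w' => /mapP[h' h'w [->]].
  exact: h'w.
split; first by rewrite adj_lex_layer.
exists [seq (g, h) | h <- w]; first exact/tolled_interior_layer.
exact: map_f.
Qed.

Lemma lex_inner_adj g x h1 h2 h : x != g ->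
  @toll_inner (lexprod G H) (g, h1) (g, h2) (x, h) -> adj g x.
Proof.
move=> xg [_ [w hw zw]].
have [[p w_p gp] | [w' w_w' _]] := lex_layer_interior hw.
  by move: zw gp; rewrite w_p inE => /eqP <-.
by move: zw; rewrite w_w' => /mapP[h' _ [xg' _]]; rewrite xg' eqxx in xg.
Qed.

Lemma lexprod_nontrivial :
  nontrivial G -> nontrivial H -> nontrivial (lexprod G H).
Proof.
rewrite /nontrivial card_prod => G2 H2.
by rewrite (leq_trans G2) // leq_pmulr // ltnW.
Qed.

End LexWalks.

Theorem theorem4p11 (G H : sgraph) (ntG : nontrivial G) (ntH : nontrivial H)
    (HnK2 : ~ isomorphic H (complete 2)) :
  tn (lexprod G H) = 2 <-> (has_universal G /\ tn H = 2).
Proof.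
rewrite !tn2P //; last exact: lexprod_nontrivial.
split=> [[u [v [uv cov]]] | [[g univ] [h1 [h2 [h12 cov]]]]].
  have [h hu] := nontrivial_other u.2 ntH.
  have uv1 : u.1 = v.1.
    apply: (lex_pair_same_layer hu) => uv1; apply: cov.
      by apply: contra_neq hu => <-.
    by apply: contra_neq uv1 => <-.
  case: u v uv1 uv cov {h hu} => [g h1] [_ h2] /= <- uv cov.
  have h12 : h1 != h2 by apply: contra_neq uv => ->.
  split.
    exists g => x xg; apply: (@lex_inner_adj G H g x h1 h2 h1 xg).
    by apply: cov; apply: contra_neq xg => -[].
  exists h1, h2; split=> // h hh1 hh2; apply/(@lex_inner_layer G H g)/cov.
    by apply: contra_neq hh1 => -[].
  by apply: contra_neq hh2 => -[].
have nh12 : ~~ adj h1 h2.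
  apply/negP=> h12_adj; apply: HnK2; apply: (isomorphic_K2 h12_adj) => z zh1.
  by apply/eqP/negPn/negP=> zh2; have [] := cov z zh1 zh2; rewrite h12_adj.
exists (g, h1), (g, h2); split; first by apply: contra_neq h12 => -[].
move=> [x h]; have [-> | xg] := eqVneq x g => hh1 hh2.
  apply/lex_inner_layer/cov; first by apply: contra_neq hh1 => ->.
  by apply: contra_neq hh2 => ->.
by apply: lex_inner_outside => //; exact: univ.
Qed.
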